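(* Let $\mathbb K$ be a field, $R=\mathbb K[x_0,\dots,x_n]$, $\mathfrak m=(x_0,\dots,x_n)$, and let $I\subset R$ be an Artinian homogeneous ideal generated by a $\mathcal P_J$-marked basis $\mathcal H$, where $J$ is a quasi-stable monomial ideal. Let $\mathcal H_0=\{h_{\alpha_1},\dots,h_{\alpha_r}\}$ be the subset of $\mathcal H$ of the polynomials whose head term is divisible by $x_0$, and for $h\in\mathcal H_0$ write $h=h'+h''$ where all terms of $h'$ are divisible by $x_0$ and no term of $h''$ is divisible by $x_0$. For each $k\in\{1,\dots,n\}$ let $A_k=A_k(\mathcal H)\in\mathbb K^{r\times r}$ be the matrix whose entry in row $i$ and column $j$ is the constant term of the coefficient polynomial $P_{h_{\alpha_i}}$ in the standard representation $x_kh_{\alpha_j}=\sum_{h\in\mathcal H}P_hh$. Then $(I:\mathfrak m)$ is the direct sum of $\mathbb K$-vector spaces $$(I:\mathfrak m)=I\oplus\Bigl\langle\Bigl\{\sum_{i=1}^r c_i\frac{h'_{\alpha_i}}{x_0}\ :\ c_i\in\mathbb K,\ \sum_{i=1}^r c_ih''_{\alpha_i}=0\ \text{ and }\ A_k\mathbf c=\mathbf 0\ \text{ for all } k\in\{1,\dots,n\}\Bigr\}\Bigr\rangle_{\mathbb K},$$ where $\mathbf c=(c_1,\dots,c_r)^T$.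
   Context: $R=\mathbb K[x_0,\dots,x_n]$ has the standard grading and variables ordered $x_0<x_1<\dots<x_n$. A term is a monomial $x^\alpha=x_0^{\alpha_0}\cdots x_n^{\alpha_n}$; for $x^\alpha\neq 1$, $\min(x^\alpha)$ (resp. $\max(x^\alpha)$) is the smallest (resp. largest) variable dividing $x^\alpha$. A variable $x_i$ is multiplicative for $x^\alpha$ if $x_i\le\min(x^\alpha)$. A monomial ideal $J$ is quasi-stable if for every term $x^\tau\in J$ and every variable $x_k>\min(x^\tau)$ there is an exponent $s_k$ with $\frac{x^\tau}{\min(x^\tau)}x_k^{s_k}\in J$. This holds if and only if $J$ has a (unique) Pommaret basis $\mathcal P_J$: a finite set of terms generating $J$ such that for every term $x^\tau\in J\setminus\mathcal P_J$ there is a unique $x^\sigma\in\mathcal P_J$ with $x^\tau=x^\delta x^\sigma$ and $\max(x^\delta)\le\min(x^\sigma)$. $\mathcal N(J)$ is the set of terms not in $J$, and $\mathcal N(J)_t$ its subset of terms of degree $t$. A $\mathcal P_J$-marked set is a set $\mathcal H=\{h_\alpha\}_{x^\alpha\in\mathcal P_J}\subset R$ of homogeneous polynomials, one for each $x^\alpha\in\mathcal P_J$, such that $x^\alpha$ (the head term of $h_\alpha$) occurs in $h_\alpha$ with coefficient $1$ and all other terms occurring in $h_\alpha$ belong to $\mathcal N(J)$. It is a $\mathcal P_J$-marked basis if $R_t=(\mathcal H)_t\oplus\langle\mathcal N(J)_t\rangle_{\mathbb K}$ for every degree $t$. Standard representation: for a $\mathcal P_J$-marked set $\mathcal H$ every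 $f\in R$ can be written uniquely as $f=\sum_{h\in\mathcal H}P_hh+g$, where each $P_h$ is a $\mathbb K$-linear combination of terms in the multiplicative variables of the head term of $h$ and $g\in\langle\mathcal N(J)\rangle_{\mathbb K}$; when $\mathcal H$ is a marked basis and $f\in(\mathcal H)$, $g=0$. An ideal $I$ is Artinian if $R/I$ has Krull dimension $0$. *)

(* Defs.v *)
From HB Require Import structures.
From mathcomp Require Import all_boot all_order all_algebra.
From mathcomp.multinomials Require Import mpoly.

Set Implicit Arguments.
Unset Strict Implicit.
Unset Printing Implicit Defensive.

Import GRing.Theory.

Local Open Scope ring_scope.

(* Ideals and K-subspaces are Prop-valued predicates, since membership in an
   arbitrary ideal is not decidable. *)

Definition is_ideal (A : comNzRingType) (I : A -> Prop) : Prop :=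
  [/\ I 0, forall f g, I f -> I g -> I (f + g) & forall a f, I f -> I (a * f)].

Definition ideal_gen (A : comNzRingType) (S : A -> Prop) (f : A) : Prop :=
  exists s : seq (A * A),
    (forall u, u \in s -> S u.2) /\ f = \sum_(u <- s) u.1 * u.2.

Definition is_prime_ideal (A : comNzRingType) (p : A -> Prop) : Prop :=
  [/\ is_ideal p, ~ p 1 & forall f g, p (f * g) -> p f \/ p g].

Definition colon (A : comNzRingType) (I M : A -> Prop) (f : A) : Prop :=
  forall g, M g -> I (f * g).

(* Chains p_0 < ... < p_d of prime ideals of A / I, seen as chains of prime
   ideals of A containing I. *)
Definition prime_chain (A : comNzRingType) (I : A -> Prop) (d : nat)
    (p : nat -> A -> Prop) : Prop :=
  (forall i, (i <= d)%N ->
     is_prime_ideal (p i) /\ (forall f, I f -> p i f)) /\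
  (forall i, (i < d)%N ->
     (forall f, p i f -> p i.+1 f) /\ (exists2 f, p i.+1 f & ~ p i f)).

Definition krull_dim_quotient (A : comNzRingType) (I : A -> Prop) (d : nat)
    : Prop :=
  (exists p, prime_chain I d p) /\ ~ (exists p, prime_chain I d.+1 p).

Definition artinian (A : comNzRingType) (I : A -> Prop) : Prop :=
  krull_dim_quotient I 0.

Definition kspan (K : fieldType) (V : lmodType K) (S : V -> Prop) (f : V)
    : Prop :=
  exists s : seq (K * V),
    (forall u, u \in s -> S u.2) /\ f = \sum_(u <- s) u.1 *: u.2.

(* U = W1 (+) W2 for K-subspaces U, W1, W2. *)
Definition direct_sum (V : zmodType) (U W1 W2 : V -> Prop) : Prop :=
  (forall f, U f <-> exists g1 g2, [/\ W1 g1, W2 g2 & f = g1 + g2]) /\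
  (forall f, W1 f -> W2 f -> f = 0).

(* The variables x_0 < x_1 < ... are ordered by their index. *)

Definition is_min_var (n : nat) (m : 'X_{1..n}) (i : 'I_n) : bool :=
  (0 < m i)%N && [forall j : 'I_n, (0 < m j)%N ==> (i <= j)%N].

Definition is_max_var (n : nat) (m : 'X_{1..n}) (i : 'I_n) : bool :=
  (0 < m i)%N && [forall j : 'I_n, (0 < m j)%N ==> (j <= i)%N].

(* The term 1 has no smallest variable; all variables are multiplicative
   for it. *)
Definition mult_var (n : nat) (m : 'X_{1..n}) (i : 'I_n) : bool :=
  [forall j : 'I_n, is_min_var m j ==> (i <= j)%N].

(* max d <= min s, vacuous if d = 1 or s = 1. *)
Definition max_le_min (n : nat) (d s : 'X_{1..n}) : bool :=
  [forall i : 'I_n, forall j : 'I_n,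
     is_max_var d i ==> is_min_var s j ==> (i <= j)%N].

Definition homogeneous_ideal (K : fieldType) (n : nat)
    (I : {mpoly K[n]} -> Prop) : Prop :=
  is_ideal I /\ forall (d : nat) (f : {mpoly K[n]}), I f -> I (pihomog mdeg d f).

Definition monomial_ideal (K : fieldType) (n : nat)
    (J : {mpoly K[n]} -> Prop) : Prop :=
  exists S : 'X_{1..n} -> Prop, forall f,
    J f <-> ideal_gen (fun g => exists2 m, S m & g = 'X_[m]) f.

(* The set N(J) of the terms outside J. *)
Definition normal_term (K : fieldType) (n : nat) (J : {mpoly K[n]} -> Prop)
    (m : 'X_{1..n}) : Prop :=
  ~ J 'X_[m].

Definition quasi_stable (K : fieldType) (n : nat) (J : {mpoly K[n]} -> Prop)
    : Prop :=
  monomial_ideal J /\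
  forall (m : 'X_{1..n}) (i k : 'I_n),
    J 'X_[m] -> is_min_var m i -> (i < k)%N ->
    exists s : nat, J 'X_[(m - U_(i) + U_(k) *+ s)%MM].

(* Finite sets of terms are duplicate-free sequences. *)
Definition pommaret_basis (K : fieldType) (n : nat) (J : {mpoly K[n]} -> Prop)
    (P : seq 'X_{1..n}) : Prop :=
  [/\ uniq P,
      forall f, J f <-> ideal_gen (fun g => exists2 m, m \in P & g = 'X_[m]) f &
      forall t : 'X_{1..n}, J 'X_[t] -> t \notin P ->
        exists! s : 'X_{1..n}, s \in P /\
          exists2 d : 'X_{1..n}, t = (d + s)%MM & max_le_min d s].

(* The marked set is { h m | m in P }; the values of h outside P are
   irrelevant. *)
Definition marked_set (K : fieldType) (n : nat) (J : {mpoly K[n]} -> Prop)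
    (P : seq 'X_{1..n}) (h : 'X_{1..n} -> {mpoly K[n]}) : Prop :=
  forall m, m \in P ->
    [/\ h m \is homog mdeg, (h m)@_m = 1 &
        forall t, t \in msupp (h m) -> t != m -> normal_term J t].

Definition marked_ideal (K : fieldType) (n : nat)
    (P : seq 'X_{1..n}) (h : 'X_{1..n} -> {mpoly K[n]}) : {mpoly K[n]} -> Prop :=
  ideal_gen (fun g => exists2 m, m \in P & g = h m).

Definition marked_basis (K : fieldType) (n : nat) (J : {mpoly K[n]} -> Prop)
    (P : seq 'X_{1..n}) (h : 'X_{1..n} -> {mpoly K[n]}) : Prop :=
  marked_set J P h /\
  forall t : nat,
    direct_sum (fun f : {mpoly K[n]} => f \is t.-homog)
      (fun f => marked_ideal P h f /\ f \is t.-homog)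
      (kspan (fun g => exists2 m, normal_term J m /\ mdeg m = t & g = 'X_[m])).

(* f = sum_(m in P) Q m * h m + g is the standard representation of f. *)
Definition std_rep (K : fieldType) (n : nat) (J : {mpoly K[n]} -> Prop)
    (P : seq 'X_{1..n}) (h Q : 'X_{1..n} -> {mpoly K[n]}) (f g : {mpoly K[n]})
    : Prop :=
  [/\ forall m, m \in P -> forall d, d \in msupp (Q m) ->
        forall i : 'I_n, (0 < d i)%N -> mult_var m i,
      kspan (fun q => exists2 m, normal_term J m & q = 'X_[m]) g &
      f = \sum_(m <- P) Q m * h m + g].

(* A = A_k: column j holds the constant terms of the coefficients, at the
   elements h (alpha i), of the standard representation of x_k h (alpha j). *)
Definition is_rep_matrix (K : fieldType) (n : nat) (J : {mpoly K[n]} -> Prop)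
    (P : seq 'X_{1..n}) (h : 'X_{1..n} -> {mpoly K[n]})
    (r : nat) (alpha : 'I_r -> 'X_{1..n}) (k : 'I_n) (A : 'M[K]_r) : Prop :=
  forall j : 'I_r, exists Q : 'X_{1..n} -> {mpoly K[n]},
    std_rep J P h Q ('X_k * h (alpha j)) 0 /\
    forall i : 'I_r, A i j = (Q (alpha i))@_0%MM.

Definition irrelevant_ideal (K : fieldType) (n : nat) : {mpoly K[n]} -> Prop :=
  ideal_gen (fun g => exists i : 'I_n, g = 'X_i).

(* f = x0_part f + x0_free_part f *)
Definition x0_part (K : fieldType) (n : nat) (f : {mpoly K[n.+1]})
    : {mpoly K[n.+1]} :=
  \sum_(m <- msupp f | (0 < m ord0)%N) f@_m *: 'X_[m].

Definition x0_free_part (K : fieldType) (n : nat) (f : {mpoly K[n.+1]})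
    : {mpoly K[n.+1]} :=
  \sum_(m <- msupp f | m ord0 == 0%N) f@_m *: 'X_[m].

(* The quotient f / x_0; only meaningful if x_0 divides every term of f, as
   the subtraction of exponents is truncated. *)
Definition div_x0 (K : fieldType) (n : nat) (f : {mpoly K[n.+1]})
    : {mpoly K[n.+1]} :=
  \sum_(m <- msupp f) f@_m *: 'X_[(m - U_(ord0))%MM].

(* Main.v *)
(* Write x_0 f = sum_i c_i h_(alpha_i), the sum running over H_0.  As x_0 is
   the only multiplicative variable of the heads in H_0, a sum
   sum_h Q_h h of standard shape that is divisible by x_0 has Q_h in (x_0) for
   h outside H_0 (a lex-maximal term of Q_h not divisible by x_0 would have
   nothing to cancel with), so it is congruent to the sum of Q_h(0) h over H_0
   modulo x_0 I.  Applied to x_0 x_k f this gives v in I with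
     x_0 (x_k f - v) = sum_i (A_k c)_i h_(alpha_i).
   Moreover x_0 u = sum_i a_i h_(alpha_i) forces u in <N(J)>, because
   alpha_i / x_0 is not in J; as <N(J)> meets I trivially, x_k f lies in I
   exactly when A_k c = 0.
   Conversely, if g in <N(J)> and x_0 g is in I, a term of x_0 g lying in J
   belongs to P_J, so subtracting the corresponding h_(alpha_i) leaves an
   element of I in <N(J)>, that is 0. *)
Require Import Defs.
From mathcomp Require Import all_boot all_order all_algebra zify.
From mathcomp.multinomials Require Import mpoly.

Set Implicit Arguments.
Unset Strict Implicit.
Unset Printing Implicit Defensive.

Import Order.TTheory GRing.Theory.

Local Open Scope ring_scope.

(** * Finite maxima, extremal variables of a term, and multiplicativity *)

Lemma seq_max (disp : Order.disp_t) (O : orderType disp) (T : eqType)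
    (key : T -> O) (s : seq T) (x0 : T) :
  x0 \in s -> exists2 x, x \in s & forall y, y \in s -> (key y <= key x)%O.
Proof.
elim: s x0 => [|a s IHs] // x0 _.
case: s IHs => [|b s] IHs.
  by exists a; rewrite ?mem_head // => y; rewrite inE => /eqP ->.
have [x xs xmax] := IHs b (mem_head _ _).
have [le_xa|lt_ax] := leP (key x) (key a).
- exists a; first exact: mem_head.
  by move=> y; rewrite inE => /predU1P[-> //|/xmax/le_trans]; apply.
- exists x; first by rewrite inE xs orbT.
  by move=> y; rewrite inE => /predU1P[->|/xmax //]; rewrite ltW.
Qed.

Lemma exists_min_var n (m : 'X_{1..n}) (j : 'I_n) :
  (0 < m j)%N -> exists2 i, is_min_var m i & (i <= j)%N.
Proof.
move=> mj.
case: (arg_minnP (P := fun i => (0 < m i)%N) (fun i : 'I_n => val i) mj).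
move=> i mi le_i; exists i; last exact: le_i.
by rewrite /is_min_var mi; apply/forallP => k; apply/implyP; apply: le_i.
Qed.

Lemma exists_max_var n (m : 'X_{1..n}) (j : 'I_n) :
  (0 < m j)%N -> exists2 i, is_max_var m i & (j <= i)%N.
Proof.
move=> mj.
case: (arg_maxnP (P := fun i => (0 < m i)%N) (fun i : 'I_n => val i) mj).
move=> i mi le_i; exists i; last exact: le_i.
by rewrite /is_max_var mi; apply/forallP => k; apply/implyP; apply: le_i.
Qed.

Lemma mult_varP n (m : 'X_{1..n}) (i : 'I_n) :
  reflect (forall j, (0 < m j)%N -> (i <= j)%N) (mult_var m i).
Proof.
apply: (iffP forallP) => [le_i j mj | le_i j].
  have [k mk le_kj] := exists_min_var mj.
  by apply: leq_trans le_kj; apply: (implyP (le_i k)).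
by apply/implyP => /andP[mj _]; apply: le_i.
Qed.

Lemma max_le_minP n (d s : 'X_{1..n}) :
  reflect (forall i j, (0 < d i)%N -> (0 < s j)%N -> (i <= j)%N)
          (max_le_min d s).
Proof.
apply: (iffP forallP) => [le_ds i j di sj | le_ds i].
  have [i' di' le_i] := exists_max_var di.
  have [j' sj' le_j] := exists_min_var sj.
  apply: leq_trans le_i (leq_trans _ le_j).
  exact: (implyP (implyP (forallP (le_ds i') j') di') sj').
apply/forallP => j; apply/implyP => /andP[di _]; apply/implyP => /andP[sj _].
exact: le_ds.
Qed.

Lemma max_le_min0 n (s : 'X_{1..n}) : max_le_min 0%MM s.
Proof. by apply/max_le_minP => i j; rewrite mnm0E. Qed.

(** For a term divisible by x_0, only x_0 is multiplicative, so an admissible cofactor is a power of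
    x_0. *)
Lemma max_le_min_x0 n (d m : 'X_{1..n.+1}) :
  max_le_min d m -> (0 < m ord0)%N -> d ord0 = 0%N -> d = 0%MM.
Proof.
move=> /max_le_minP mult m0 d0; apply/mnmP => i; rewrite mnm0E.
case: (posnP (d i)) => // di; have := mult i ord0 di m0;
  rewrite leqn0 => /eqP i0.
have eq_i : i = ord0 by apply: val_inj.
by rewrite eq_i d0 in di.
Qed.

(** Being the smallest variable, x_0 is multiplicative for every term. *)
Lemma max_le_min_addx0 n (d s : 'X_{1..n.+1}) k :
  max_le_min d s -> max_le_min (d + U_(ord0) *+ k)%MM s.
Proof.
move/max_le_minP => mult; apply/max_le_minP => i j.
case: (eqVneq i ord0) => [-> //|i0];
  rewrite mnmDE mulmnE mnm1E eq_sym (negbTE i0).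
by rewrite mul0n addn0; apply: mult.
Qed.

(** * The lexicographic order on cofactors *)

(* Reversal makes the largest variable the most significant one. *)
Definition lex_key n (d : 'X_{1..n}) : n.-tuplelexi nat :=
  [tuple d (rev_ord i) | i < n].

Lemma lex_key_inj n : injective (@lex_key n).
Proof.
move=> d e /(congr1 (fun t : n.-tuple nat => tnth t)) eq_de.
apply/mnmP => i; rewrite -(rev_ordK i).
by have := congr1 (@^~ (rev_ord i)) eq_de; rewrite /= !tnth_mktuple.
Qed.

Lemma lex_key_ltP n (d e : 'X_{1..n}) : (lex_key d < lex_key e)%O ->
  exists2 i : 'I_n, forall j : 'I_n, (i < j)%N -> d j = e j & (d i < e i)%N.
Proof.
case/Order.TupleLexiOrder.ltxi_tuplePlt => k eq_de lt_de.
exists (rev_ord k); last by move: lt_de; rewrite !tnth_mktuple.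
move=> j lt_kj; have := eq_de (rev_ord j).
rewrite !tnth_mktuple !rev_ordK; apply => /=.
by move: lt_kj (ltn_ord j) (ltn_ord k) => /=; lia.
Qed.

Lemma lex_key0 n (d : 'X_{1..n}) : (lex_key 0%MM <= lex_key d)%O.
Proof.
rewrite leNgt; apply/negP => /lex_key_ltP[i _]; by rewrite mnm0E.
Qed.

(* If [d e] differ first at x_i with d_i < e_i, all variables of s are at least
   x_i, so s would divide b. *)
Lemma mult_lex_lt n (d b e s : 'X_{1..n}) :
  (d + b = e + s)%MM -> max_le_min e s -> ~~ (s <= b)%MM ->
  (lex_key e < lex_key d)%O.
Proof.
move=> /mnmP eq_dbes /max_le_minP mult_es; apply: contraNT.
rewrite -leNgt le_eqVlt => /predU1P[/lex_key_inj eq_de|/lex_key_ltP[i eq_de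
  lt_de]].
  apply/mnm_lepP => j; have := eq_dbes j; rewrite !mnmDE eq_de.
  by move/addnI ->.
apply/mnm_lepP => j; have := eq_dbes j; rewrite !mnmDE.
have [lt_ij|lt_ji|/val_inj eq_ij] := ltngtP i j.
- by rewrite (eq_de j lt_ij); lia.
- case: (posnP (s j)) => [-> //|sj].
  by have := mult_es i j (leq_ltn_trans (leq0n _) lt_de) sj; lia.
- by subst j; lia.
Qed.

(** * Coefficients of products, and division by x_0 *)

Section Coefficients.
Variables (K : fieldType).

Lemma mcoeff_MX n (d t : 'X_{1..n}) (f : {mpoly K[n]}) :
  ('X_[d] * f)@_t = if (d <= t)%MM then f@_(t - d) else 0.
Proof.
case: ifPn => [le_dt|nle_dt].
  by rewrite -{1}(submK le_dt) addmC mulrC mcoeffMX.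
apply: memN_msupp_eq0; apply: contra nle_dt.
move/msuppM_le/allpairsP => [[u v] /= [+ _ ->]].
by rewrite msuppX inE => /eqP ->; apply: lem_addr.
Qed.

Lemma mcoeff_M n (f g : {mpoly K[n]}) (t : 'X_{1..n}) :
  (f * g)@_t = \sum_(d <- msupp f | (d <= t)%MM) f@_d * g@_(t - d).
Proof.
rewrite {1}(mpolyE f) mulr_suml raddf_sum /= [RHS]big_mkcond /=.
apply: eq_bigr => d _; rewrite -scalerAl mcoeffZ mcoeff_MX.
by case: ifP => // _; rewrite mulr0.
Qed.

Lemma mcoeff_sumX n (s : seq 'X_{1..n}) (p : pred 'X_{1..n})
    (a : 'X_{1..n} -> K) (t : 'X_{1..n}) :
  uniq s ->
  (\sum_(m <- s | p m) a m *: 'X_[m] : {mpoly K[n]})@_t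
    = if (t \in s) && p t then a t else 0.
Proof.
move=> uniq_s; rewrite raddf_sum /= big_mkcond /=.
case: ifPn => [/andP[ts pt]|nt].
  rewrite (bigD1_seq t) //= pt mcoeffZ mcoeffX eqxx mulr1 big1 ?addr0 // => m
    ne.
  by case: ifP => // _; rewrite mcoeffZ mcoeffX (negbTE ne) mulr0.
rewrite big1_seq // => m /andP[_ ms]; case: ifP => // pm.
rewrite mcoeffZ mcoeffX; case: eqP => [eq_mt|]; last by rewrite mulr0.
by rewrite -eq_mt ms pm in nt.
Qed.

Lemma mcoeff_x0_part n (f : {mpoly K[n.+1]}) (t : 'X_{1..n.+1}) :
  (x0_part f)@_t = if (0 < t ord0)%N then f@_t else 0.
Proof.
rewrite mcoeff_sumX // andbC; case: (0 < t ord0)%N => //=.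
by case: ifPn => // /memN_msupp_eq0 ->.
Qed.

Lemma mcoeff_x0_free_part n (f : {mpoly K[n.+1]}) (t : 'X_{1..n.+1}) :
  (x0_free_part f)@_t = if t ord0 == 0%N then f@_t else 0.
Proof.
rewrite mcoeff_sumX // andbC; case: (t ord0 == 0%N) => //=.
by case: ifPn => // /memN_msupp_eq0 ->.
Qed.

Lemma x0_partD n (f : {mpoly K[n.+1]}) : x0_part f + x0_free_part f = f.
Proof.
apply/mpolyP => t; rewrite mcoeffD mcoeff_x0_part mcoeff_x0_free_part.
by case: (posnP (t ord0)) => _; rewrite ?add0r ?addr0.
Qed.

Lemma mul_x0_div n (f : {mpoly K[n.+1]}) :
  (forall t, t \in msupp f -> (0 < t ord0)%N) -> 'X_ord0 * div_x0 f = f.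
Proof.
move=> div_f; rewrite {2}(mpolyE f) mulr_sumr; apply: eq_big_seq => t tf.
rewrite -scalerAr -mpolyXD addmC submK //.
apply/mnm_lepP => i; rewrite mnm1E; case: eqP => // <-.
exact: div_f.
Qed.

Lemma mul_x0_div_part n (f : {mpoly K[n.+1]}) :
  'X_ord0 * div_x0 (x0_part f) = x0_part f.
Proof.
apply: mul_x0_div => t; rewrite mcoeff_msupp mcoeff_x0_part.
by case: ifP; rewrite ?eqxx.
Qed.

Lemma mcoeff_mul_x0_free n (f : {mpoly K[n.+1]}) (t : 'X_{1..n.+1}) :
  t ord0 = 0%N -> ('X_ord0 * f)@_t = 0.
Proof.
move=> t0; rewrite mcoeff_MX; case: ifP => // /mnm_lepP /(_ ord0).
by rewrite mnm1E t0.
Qed.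

Lemma mulX_inj n (i : 'I_n) : injective (fun f : {mpoly K[n]} => 'X_i * f).
Proof.
move=> f g eq_fg; apply/mpolyP => t; have := congr1 (mcoeff (U_(i) + t)) eq_fg.
by rewrite !(mulrC 'X_i) !mcoeffMX.
Qed.

End Coefficients.

(** * Normal supports, spans of terms and homogeneous components *)

(** Membership in the span of N(J), phrased on supports so that it can be checked term by term;
    [kspan_monomials] gives the equivalence. *)
Definition normal_supp (K : fieldType) n (J : {mpoly K[n]} -> Prop)
    (f : {mpoly K[n]}) : Prop :=
  forall t, t \in msupp f -> normal_term J t.

Lemma normal_supp_lin (K : fieldType) n (J : {mpoly K[n]} -> Prop)
    (c : K) (f g : {mpoly K[n]}) :
  normal_supp J f -> normal_supp J g -> normal_supp J (c *: f + g).
Proof.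
move=> Nf Ng t /msuppD_le; rewrite mem_cat => /orP[/msuppZ_le|];
  [exact: Nf|exact: Ng].
Qed.

Lemma kspan_monomials (K : fieldType) n (S : 'X_{1..n} -> Prop)
    (f : {mpoly K[n]}) :
  kspan (fun g => exists2 m, S m & g = 'X_[m]) f <->
  forall t, t \in msupp f -> S t.
Proof.
split=> [[s [Ss ->]] t|Sf].
  rewrite mcoeff_msupp raddf_sum /=; elim: s Ss => [|u s IHs] Ss.
    by rewrite big_nil eqxx.
  rewrite big_cons; have [m Sm eq_u] := Ss u (mem_head _ _).
  rewrite mcoeffZ eq_u mcoeffX; case: (m =P t) => [<- //|_].
  by rewrite mulr0 add0r; apply: IHs => v vs; apply: Ss; rewrite inE vs orbT.
exists [seq (f@_m, 'X_[m]) | m <- msupp f]; split.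
  by move=> u /mapP[m mf ->]; exists m => //; apply: Sf.
by rewrite big_map {1}(mpolyE f).
Qed.

Lemma kspan_ind (K : fieldType) (V : lmodType K) (S D : V -> Prop) :
  D 0 -> (forall c f g, D f -> D g -> D (c *: f + g)) ->
  (forall f, S f -> D f) -> forall f, kspan S f -> D f.
Proof.
move=> D0 DD SD f [s [Ss ->]]; elim: s Ss => [|u s IHs] Ss.
  by rewrite big_nil.
rewrite big_cons; apply: DD.
  by apply/SD/Ss/mem_head.
by apply: IHs => v vs; apply: Ss; rewrite inE vs orbT.
Qed.

Lemma mcoeff_pihomog (K : fieldType) n (d : nat) (f : {mpoly K[n]})
    (t : 'X_{1..n}) :
  (pihomog mdeg d f)@_t = if mdeg t == d then f@_t else 0.
Proof.
rewrite pihomogE mcoeff_sumX // andbC; case: (mdeg t == d) => //=.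
by case: ifPn => // /memN_msupp_eq0 ->.
Qed.

(** * Ideals and the colon by the irrelevant ideal *)

Section Ideal.
Variables (K : fieldType) (n : nat) (I : {mpoly K[n]} -> Prop).
Hypothesis I_ideal : is_ideal I.

Lemma idealZ c f : I f -> I (c *: f).
Proof. by case: I_ideal => _ _ IM If; rewrite -mul_mpolyC; apply: IM. Qed.

Lemma idealB f g : I f -> I g -> I (f - g).
Proof.
by case: I_ideal => _ ID _ If Ig; apply: ID => //; rewrite -scaleN1r;
  apply: idealZ.
Qed.

Lemma ideal_sum (T : eqType) (s : seq T) (F : T -> {mpoly K[n]}) :
  (forall x, x \in s -> I (F x)) -> I (\sum_(x <- s) F x).
Proof. by case: I_ideal => I0 ID _ IF; rewrite big_seq; apply: (big_ind I). Qed.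

Lemma colon_irrelevantP f :
  colon I (@irrelevant_ideal K n) f <-> forall k, I ('X_k * f).
Proof.
case: I_ideal => I0 ID IM; split=> [If k|If g [s [Ss ->]]].
  rewrite mulrC; apply: If; exists [:: (1, 'X_k)].
  by split=> [u|]; rewrite ?big_seq1 ?mul1r // inE => /eqP -> /=; exists k.
rewrite mulr_sumr; apply: ideal_sum => u /Ss[k ->].
by rewrite mulrCA (mulrC f); apply: IM; apply: If.
Qed.

End Ideal.

(** * Pommaret bases and multiplication of terms by x_0 *)

Section Pommaret.
Variables (K : fieldType) (n : nat) (J : {mpoly K[n.+1]} -> Prop).
Variable P : seq 'X_{1..n.+1}.
Hypothesis P_pommaret : pommaret_basis J P.

(** A term occurring in a combination of elements of [P] occurs in one of its summands, hence is a
    multiple of an element of [P]. *)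
Lemma pommaret_memP t : reflect (J 'X_[t]) (has (fun s => (s <= t)%MM) P).
Proof.
case: P_pommaret => _ genJ _; apply: (iffP hasP) => [[s sP le_st]|].
  apply/genJ; exists [:: ('X_[t - s], 'X_[s])]; split.
    by move=> u; rewrite inE => /eqP -> /=; exists s.
  by rewrite big_seq1 /= -mpolyXD submK.
case/genJ => w [Pw eq_t].
have : t \in msupp ('X_[t] : {mpoly K[n.+1]}) by rewrite msuppX inE.
rewrite eq_t => /msupp_sum_le /flattenP[l /mapP[u]].
rewrite mem_filter /= => /Pw[s sP eq_u] ->; rewrite eq_u.
move/msuppM_le/allpairsP => [[d e] /= [_ + ->]].
by rewrite msuppX inE => /eqP ->; exists s; rewrite ?lem_addl.
Qed.

Lemma pommaret_mem t : t \in P -> J 'X_[t].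
Proof. by move=> tP; apply/pommaret_memP/hasP; exists t;
  rewrite ?lepm_refl. Qed.

(** Divisibility by an element of the finite list [P] is decidable, so this case split needs no
    classical axiom. *)
Lemma normal_termP t : J 'X_[t] \/ normal_term J t.
Proof. by case: (pommaret_memP t); [left | right]. Qed.

Lemma normal_termN b s : normal_term J b -> s \in P -> ~~ (s <= b)%MM.
Proof.
move=> Nb sP; apply/negP => le_sb; apply: Nb.
by apply/pommaret_memP/hasP; exists s.
Qed.

Lemma pommaret_exists t : J 'X_[t] ->
  exists2 s : 'X_{1..n.+1}, s \in P & exists2 d, t = (d + s)%MM & max_le_min d
    s.
Proof.
move=> Jt; case: (boolP (t \in P)) => tP.
  by exists t => //; exists 0%MM; rewrite ?add0m ?max_le_min0.
case: P_pommaret => _ _ /(_ t Jt tP)[s [[sP [d eq_t mult]] _]].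
by exists s => //; exists d.
Qed.

(* The definition grants uniqueness only for terms outside P; multiplying by a
   high power of x_0, which is always multiplicative, leaves P. *)
Lemma pommaret_uniq d s d' s' :
  s \in P -> s' \in P -> max_le_min d s -> max_le_min d' s' ->
  (d + s = d' + s')%MM -> s = s'.
Proof.
move=> sP s'P mult mult' eq_ds.
(* One more than the sum of all x_0-exponents in [P]: no element of [P] is divisible by this power
   of x_0, whereas [t] is. *)
pose k := (\sum_(p <- P) p ord0).+1.
pose t := (d + U_(ord0) *+ k + s)%MM.
have eq_t : t = (d' + U_(ord0) *+ k + s')%MM.
  by rewrite /t -!addmA !(addmC (_ *+ k)%MM) !addmA eq_ds.
have Jt : J 'X_[t].
  by apply/pommaret_memP/hasP; exists s; rewrite ?lem_addl.
have tNP : t \notin P.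
  apply/negP => tP; have : (t ord0 < k)%N.
    by rewrite ltnS (bigD1_seq t) ?leq_addr //; case: P_pommaret.
  by rewrite !mnmDE mulmnE mnm1E eqxx mul1n; lia.
case: P_pommaret => _ _ /(_ t Jt tNP)[s0 [_ uniq_s0]].
have <- : s0 = s.
  by apply: uniq_s0; split=> //; exists (d + U_(ord0) *+ k)%MM => //;
    apply: max_le_min_addx0.
by apply: uniq_s0; split=> //; exists (d' + U_(ord0) *+ k)%MM => //;
  apply: max_le_min_addx0.
Qed.

(** Factor x_0 b as d s with s in [P]. If x_0 divided d, cancelling it would make b a multiple of s;
    so x_0 divides s, and then d = 1. *)
Lemma normal_mul_x0 b :
  normal_term J b -> J 'X_[U_(ord0) + b] -> (U_(ord0) + b)%MM \in P.
Proof.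
move=> Nb /pommaret_exists[s sP [d eq_t mult]].
have /mnmP/(_ ord0) := eq_t; rewrite !mnmDE mnm1E eqxx => eq_t0.
case: (posnP (d ord0)) => d0.
  by rewrite eq_t (max_le_min_x0 mult) ?add0m //; lia.
case: (negP (normal_termN Nb sP)); apply/mnm_lepP => i.
have /mnmP/(_ i) := eq_t; rewrite !mnmDE mnm1E; case: eqP => [<-|_] /=; lia.
Qed.

(** If t = d s were a Pommaret factorization, (x_0 d) s would be one of x_0 t beside the trivial
    one; uniqueness gives s = x_0 t, whose x_0-exponent exceeds that of t. *)
Lemma pommaret_div_x0 t : (U_(ord0) + t)%MM \in P -> normal_term J t.
Proof.
move=> tP /pommaret_exists[s sP [d eq_t mult]].
have eq_s : (U_(ord0) + t = d + U_(ord0) *+ 1 + s)%MM.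
  by rewrite eq_t mulm1n addmA (addmC U_(_)%MM).
have := pommaret_uniq sP tP (max_le_min_addx0 1 mult) (max_le_min0 _).
rewrite -eq_s add0m => /(_ erefl) eq_st.
move/mnmP/(_ ord0): eq_s; rewrite eq_st mulm1n !mnmDE mnm1E eqxx; lia.
Qed.

End Pommaret.

(** * Marked bases: normal forms and sums of standard shape *)

Section MarkedBasis.
Variables (K : fieldType) (n : nat) (J : {mpoly K[n.+1]} -> Prop).
Variables (P : seq 'X_{1..n.+1}) (h : 'X_{1..n.+1} -> {mpoly K[n.+1]}).
Variable I : {mpoly K[n.+1]} -> Prop.
Hypothesis P_pommaret : pommaret_basis J P.
Hypothesis h_basis : marked_basis J P h.
Hypothesis I_homogeneous : homogeneous_ideal I.
Hypothesis I_generated : forall f, I f <-> marked_ideal P h f.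

Let uniq_P : uniq P. Proof. by case: P_pommaret. Qed.
Let I_ideal : is_ideal I. Proof. by case: I_homogeneous. Qed.

Lemma marked_mem m : m \in P -> I (h m).
Proof.
move=> mP; apply/I_generated; exists [:: (1, h m)]; split.
  by move=> u; rewrite inE => /eqP -> /=; exists m.
by rewrite big_seq1 mul1r.
Qed.

Lemma marked_supp m t :
  m \in P -> t \in msupp (h m) -> t = m \/ normal_term J t.
Proof.
case: h_basis => marked _ /marked[_ _ tail] th.
by case: (eqVneq t m) => [|/(tail t th)]; [left | right].
Qed.

Lemma marked_coeffJ m t : m \in P -> J 'X_[t] -> (h m)@_t = (m == t)%:R.
Proof.
move=> mP Jt; case: (eqVneq m t) => [<-|ne_mt].
  by case: h_basis => marked _; case/marked: mP.
apply/eqP; rewrite mcoeff_eq0; apply/negP => /(marked_supp mP)[eq_tm|//].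
by rewrite eq_tm eqxx in ne_mt.
Qed.

(** Since [I] is homogeneous, the trivial intersection granted in each degree applies to every
    homogeneous component of [f]. *)
Lemma normal_ideal_eq0 f : I f -> normal_supp J f -> f = 0.
Proof.
move=> If Nf; rewrite (pihomog_partitionE (leqnn (mmeasure mdeg f))).
rewrite big1 // => d _; case: h_basis => _ /(_ d)[_]; apply.
  by split; [apply/I_generated/I_homogeneous.2 | apply: pihomogP].
apply/kspan_monomials => t; rewrite mcoeff_msupp mcoeff_pihomog.
case: (mdeg t =P d) => [eq_d tf|_]; last by rewrite eqxx.
by split=> //; apply: Nf; rewrite mcoeff_msupp.
Qed.

Lemma marked_decomposition (f : {mpoly K[n.+1]}) :
  exists2 g, normal_supp J g & I (f - g).
Proof.
case: I_ideal => I0 ID _.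
rewrite (pihomog_partitionE (leqnn (mmeasure mdeg f))).
apply: (big_ind (fun f => exists2 g, normal_supp J g & I (f - g))).
- by exists 0; [move=> t; rewrite msupp0 | rewrite subr0].
- move=> f1 f2 [g1 N1 I1] [g2 N2 I2]; exists (g1 + g2).
    by rewrite -[g1]scale1r; apply: normal_supp_lin.
  by rewrite opprD addrACA; apply: ID.
- move=> d _; case: h_basis => _ /(_ d)[/(_ (pihomog mdeg d f))[+ _] _].
  case; first exact: pihomogP.
  move=> g1 [g2 [[/I_generated I1 _] /kspan_monomials N2 ->]].
  by exists g2; [move=> t /N2[] | rewrite addrK].
Qed.

(* Among the terms d m with d and m free of x_0, take the one with d lex
   maximal: by [mult_lex_lt] nothing in the sum can cancel it. *)
Lemma marked_sum_x0_free (Q : 'X_{1..n.+1} -> {mpoly K[n.+1]}) :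
  (forall m, m \in P -> forall d, d \in msupp (Q m) -> max_le_min d m) ->
  (forall t : 'X_{1..n.+1}, t ord0 = 0%N -> (\sum_(m <- P) Q m * h m)@_t = 0) ->
  forall m d, m \in P -> d \in msupp (Q m) -> d ord0 = 0%N -> (0 < m ord0)%N.
Proof.
move=> multQ sum0.
(* All pairs of a head and a cofactor, both free of x_0: the finite set in which the lex-maximal
   cofactor is sought. *)
pose s := [seq u : 'X_{1..n.+1} * 'X_{1..n.+1} <- [seq (m, d) | m <- P, d <-
  msupp (Q m)]
             | (u.1 ord0 == 0%N) && (u.2 ord0 == 0%N)].
have s_mem (m d : 'X_{1..n.+1}) : m \in P -> d \in msupp (Q m) -> m ord0 = 0%N
  ->
    d ord0 = 0%N -> (m, d) \in s.
  move=> mP dQ m0 d0; rewrite mem_filter /= m0 d0 eqxx /=.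
  by apply/allpairsPdep; exists m, d.
move=> m1 d1 m1P d1Q d10; case: (posnP (m1 ord0)) => // m10; exfalso.
have [[m d]] := seq_max (fun u => lex_key u.2) (s_mem m1 d1 m1P d1Q m10 d10).
rewrite mem_filter => /andP[/= /andP[/eqP m0 /eqP d0]].
case/allpairsPdep => [m' [d' [mP dQ [eq_m eq_d]]]] maxd; subst m' d'.
have dm0 : (d + m)%MM ord0 = 0%N by rewrite mnmDE d0 m0.
(* Only the chosen pair contributes to the coefficient at d m. A contribution through a head is
   excluded by uniqueness of Pommaret factorizations, one through a tail term because it forces a
   lex-larger d'. *)
have contrib (m' d' : 'X_{1..n.+1}) : m' \in P -> d' \in msupp (Q m') -> (d' <=
  d + m)%MM ->
    (h m')@_(d + m - d') != 0 -> m' = m /\ d' = d.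
  move=> m'P d'Q le_d'; rewrite -mcoeff_msupp => /(marked_supp m'P).
  have eq_dm : (d' + (d + m - d') = d + m)%MM by rewrite addmC submK.
  case=> [eq_m'|Nb].
    rewrite eq_m' in eq_dm.
    have eq_m := pommaret_uniq P_pommaret m'P mP (multQ _ m'P _ d'Q)
                   (multQ _ mP _ dQ) eq_dm.
    by split=> //; move: eq_dm; rewrite eq_m => /(congr1 (fun e => e - m)%MM);
      rewrite !addmK.
  have lt_d := mult_lex_lt eq_dm (multQ _ mP _ dQ)
                 (normal_termN P_pommaret Nb mP).
  have d'0 : d' ord0 = 0%N.
    by have /mnm_lepP/(_ ord0) := le_d'; rewrite dm0 leqn0 => /eqP.
  (* Either (m', d') is in [s], against maximality of d, or x_0 divides m', so that d' = 1, which is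
     lex-minimal and cannot exceed d. *)
  case: (posnP (m' ord0)) => m'0.
    by have := maxd _ (s_mem m' d' m'P d'Q m'0 d'0); rewrite leNgt lt_d.
  by move: lt_d; rewrite (max_le_min_x0 (multQ _ m'P _ d'Q) m'0 d'0) ltNge
    lex_key0.
(* The coefficient at d m thus reduces to that of d in [Q m], which is nonzero. *)
move: (sum0 _ dm0); rewrite raddf_sum /= (bigD1_seq m) //= [X in _ + X]big1_seq
  ?addr0.
  rewrite mcoeff_M big_mkcond (bigD1_seq d) ?msupp_uniq //= lem_addr.
  rewrite [X in _ + X]big1_seq ?addr0 => [|d' /andP[ne_d d'Q]].
    have eq_m : (d + m - d = m)%MM by rewrite addmC addmK.
    rewrite eq_m marked_coeffJ ?eqxx ?mulr1;
      last exact: (pommaret_mem P_pommaret).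
      by move/eqP; rewrite mcoeff_eq0 dQ.
    by [].
  case: ifP => // le_d'; apply/eqP; rewrite mulf_eq0 orbC.
  by apply/orP; left; apply: contraNT ne_d => /(contrib m d' mP d'Q le_d')[_
    ->].
move=> m' /andP[ne_m m'P]; rewrite mcoeff_M big_seq_cond big1 // => d'
  /andP[d'Q le_d'].
apply/eqP; rewrite mulf_eq0 orbC.
by apply/orP; left; apply: contraNT ne_m => /(contrib m' d' m'P d'Q le_d')[->
  _].
Qed.

(** By [marked_sum_x0_free], an x_0-free term of [Q m] forces x_0 to divide [m], so that term is 1.
    Hence all nonconstant terms are divisible by x_0, and constant terms survive only at heads
    divisible by x_0. *)
Lemma marked_sum_mod_x0 (Q : 'X_{1..n.+1} -> {mpoly K[n.+1]}) :
  (forall m, m \in P -> forall d, d \in msupp (Q m) -> max_le_min d m) ->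
  (forall t : 'X_{1..n.+1}, t ord0 = 0%N -> (\sum_(m <- P) Q m * h m)@_t = 0) ->
  exists2 v, I v &
    \sum_(m <- P) Q m * h m =
      \sum_(m <- P | (0 < m ord0)%N) (Q m)@_0%MM *: h m + 'X_ord0 * v.
Proof.
move=> multQ sum0; have x0_head := marked_sum_x0_free multQ sum0.
pose Q' m := div_x0 (Q m - ((Q m)@_0%MM)%:MP).
exists (\sum_(m <- P) Q' m * h m).
  by apply: ideal_sum => // m mP; case: I_ideal => _ _; apply;
    apply: marked_mem.
rewrite mulr_sumr [X in X + _]big_mkcond -big_split;
  apply: eq_big_seq => m mP /=.
have -> : (if (0 < m ord0)%N then (Q m)@_0%MM *: h m else 0) = (Q m)@_0%MM *: h
  m.
  case: ifPn => // m0; rewrite memN_msupp_eq0 ?scale0r //.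
  by apply: contra m0 => dQ; apply: (x0_head _ _ mP dQ); rewrite mnm0E.
rewrite mulrA /Q' mul_x0_div.
  by rewrite mulrBl mul_mpolyC addrC subrK.
move=> d; rewrite mcoeff_msupp mcoeffB mcoeffC.
case: (eqVneq d 0%MM) => [->|nz_d]; first by rewrite mulr1 subrr eqxx.
rewrite mulr0 subr0 -mcoeff_msupp => dQ.
case: (posnP (d ord0)) => // d0; case/eqP: nz_d.
exact: max_le_min_x0 (multQ _ mP _ dQ) (x0_head _ _ mP dQ d0) d0.
Qed.

(** * Linear combinations of the marked polynomials whose heads are divisible by x_0 *)

Variables (r : nat) (alpha : 'I_r -> 'X_{1..n.+1}).
Hypothesis alpha_inj : injective alpha.
Hypothesis alpha_enum : forall m,
  (m \in P /\ (0 < m ord0)%N) <-> exists i : 'I_r, alpha i = m.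

Let alphaP i : alpha i \in P.
Proof. by case: ((alpha_enum (alpha i)).2 (ex_intro _ i erefl)). Qed.

Lemma sum_x0_heads (F : 'X_{1..n.+1} -> {mpoly K[n.+1]}) :
  \sum_(m <- P | (0 < m ord0)%N) F m = \sum_(i < r) F (alpha i).
Proof.
rewrite -big_filter -(big_map alpha predT F); apply: perm_big.
apply: uniq_perm; first exact: filter_uniq.
  by rewrite map_inj_uniq // index_enum_uniq.
move=> m; rewrite mem_filter andbC; apply/andP/mapP.
  by case/alpha_enum => i <-; exists i; rewrite ?mem_index_enum.
by case=> i _ ->; apply/alpha_enum; exists i.
Qed.

Lemma mcoeff_comb_heads (a : 'I_r -> K) t : J 'X_[t] ->
  (\sum_(i < r) a i *: h (alpha i))@_t = \sum_(i < r | alpha i == t) a i.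
Proof.
move=> Jt; rewrite raddf_sum [RHS]big_mkcond; apply: eq_bigr => i _ /=.
by rewrite mcoeffZ marked_coeffJ //; case: eqP; rewrite ?mulr1 ?mulr0.
Qed.

Lemma mcoeff_comb_head (a : 'I_r -> K) i :
  (\sum_(i < r) a i *: h (alpha i))@_(alpha i) = a i.
Proof.
rewrite mcoeff_comb_heads; last exact: (pommaret_mem P_pommaret).
by rewrite (eq_bigl (eq_op^~ i)) ?big_pred1_eq // => j;
  rewrite (inj_eq alpha_inj).
Qed.

(** A term t of [u] in J would put x_0 t on the right-hand side; the only terms of J there are
    heads, contradicting [pommaret_div_x0]. *)
Lemma x0_quotient_normal (a : 'I_r -> K) (u : {mpoly K[n.+1]}) :
  'X_ord0 * u = \sum_(i < r) a i *: h (alpha i) -> normal_supp J u.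
Proof.
move=> eq_u t tu; case: (normal_termP P_pommaret t) => // Jt.
have JU : J 'X_[U_(ord0) + t].
  apply/(pommaret_memP P_pommaret).
  case/(pommaret_memP P_pommaret)/hasP: Jt => s sP le_st.
  by apply/hasP; exists s => //; apply: lepm_trans le_st (lem_addl _ _).
have := congr1 (mcoeff (U_(ord0) + t)) eq_u.
rewrite mulrC mcoeffMX mcoeff_comb_heads // big1 => [|i /eqP eq_i].
  by move/eqP; rewrite mcoeff_eq0 tu.
by have := alphaP i; rewrite eq_i => /(pommaret_div_x0 P_pommaret).
Qed.

(** Comparing x_0-free terms annihilates the combination of the h''; cancelling x_0 from the
    remaining part gives [f]. This turns the spanning set of the theorem into a condition on x_0
    f. *)
Lemma x0_quotientP (c : 'I_r -> K) (f : {mpoly K[n.+1]}) :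
  'X_ord0 * f = \sum_(i < r) c i *: h (alpha i) <->
  f = \sum_(i < r) c i *: div_x0 (x0_part (h (alpha i))) /\
  \sum_(i < r) c i *: x0_free_part (h (alpha i)) = 0.
Proof.
have x0_sum : 'X_ord0 * (\sum_(i < r) c i *: div_x0 (x0_part (h (alpha i)))) =
    \sum_(i < r) c i *: h (alpha i) -
    \sum_(i < r) c i *: x0_free_part (h (alpha i)).
  rewrite mulr_sumr -sumrB; apply: eq_bigr => i _.
  by rewrite -scalerAr mul_x0_div_part -scalerBr -{2}(x0_partD (h _)) addrK.
split=> [eq_f|[-> free0]]; last by rewrite x0_sum free0 subr0.
have free0 : \sum_(i < r) c i *: x0_free_part (h (alpha i)) = 0.
  apply/mpolyP => t; rewrite mcoeff0 raddf_sum /=.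
  case: (eqVneq (t ord0) 0%N) => [t0|nz_t0]; last first.
    by rewrite big1 // => i _; rewrite mcoeffZ mcoeff_x0_free_part (negbTE
      nz_t0) mulr0.
  rewrite -[RHS](mcoeff_mul_x0_free f t0) eq_f raddf_sum;
    apply: eq_bigr => i _ /=.
  by rewrite !mcoeffZ mcoeff_x0_free_part t0.
by split=> //; apply: (@mulX_inj _ _ ord0); rewrite /= x0_sum free0 subr0.
Qed.

Lemma rep_matrix_mul k (Ak : 'M[K]_r) (c : 'cV[K]_r) (f : {mpoly K[n.+1]}) :
  is_rep_matrix J P h alpha k Ak ->
  'X_ord0 * f = \sum_(i < r) c i 0 *: h (alpha i) ->
  exists2 v, I v &
    'X_ord0 * ('X_k * f - v) = \sum_(i < r) (Ak *m c) i 0 *: h (alpha i).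
Proof.
move=> /fin_all_exists[Q repQ] eq_f.
(* Multiplicativity is stable under linear combination, so the standard representations of the x_k
   h_(alpha_j) combine into one of x_0 x_k f; its constant terms at the heads form the vector A_k
   c. *)
pose Qc m := \sum_(j < r) c j 0 *: Q j m.
have eq_kf : 'X_ord0 * ('X_k * f) = \sum_(m <- P) Qc m * h m.
  rewrite mulrCA eq_f mulr_sumr.
  under [RHS]eq_bigr do rewrite mulr_suml.
  rewrite exchange_big; apply: eq_bigr => j _ /=.
  case: (repQ j) => -[_ _ eq_j] _; rewrite -scalerAr eq_j addr0 scaler_sumr.
  by apply: eq_bigr => m _; rewrite scalerAl.
have multQ m : m \in P -> forall d, d \in msupp (Qc m) -> max_le_min d m.
  move=> mP d /msupp_sum_le/flattenP[l /mapP[j _ ->]] /msuppZ_le dQ.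
  apply/max_le_minP => i i' di mi'; case: (repQ j) => -[mult _ _] _.
  exact: (mult_varP _ _ (mult m mP d dQ i di)).
have [|v Iv eq_v] := marked_sum_mod_x0 multQ.
  by move=> t t0; rewrite -eq_kf mcoeff_mul_x0_free.
exists v => //; rewrite mulrBr eq_kf eq_v addrK sum_x0_heads.
apply: eq_bigr => i _; congr (_ *: _); rewrite mxE raddf_sum.
apply: eq_bigr => j _; rewrite /= mcoeffZ mulrC; congr (_ * _).
by case: (repQ j) => _ ->.
Qed.

(** With coefficients read off at the heads, the two sides agree on all terms of J; their difference
    is a normal element of [I]. *)
Lemma normal_x0_comb (g : {mpoly K[n.+1]}) : normal_supp J g -> I ('X_ord0 * g)
  ->
  exists c : 'cV[K]_r, 'X_ord0 * g = \sum_(i < r) c i 0 *: h (alpha i).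
Proof.
move=> Ng Ig; pose c := (\col_i ('X_ord0 * g)@_(alpha i)) : 'cV[K]_r.
exists c; apply/eqP; rewrite -subr_eq0; apply/eqP; apply: normal_ideal_eq0.
  apply: idealB => //; apply: ideal_sum => // i _.
  by apply: idealZ => //; apply: marked_mem.
move=> t tw; case: (normal_termP P_pommaret t) => // Jt; exfalso; move: tw.
rewrite mcoeff_msupp mcoeffB; case/negP; rewrite subr_eq0; apply/eqP.
case: (pickP (fun i => alpha i == t)) => [i /eqP <-|no_i].
  by rewrite mcoeff_comb_head mxE.
(* At a term of J that is no head the right side vanishes. If x_0 g contained it, [normal_mul_x0]
   would place it in [P], making it a head after all. *)
rewrite mcoeff_comb_heads // big_pred0 // mcoeff_MX; case: ifP => // le_t.
have eq_t : (U_(ord0) + (t - U_(ord0)) = t)%MM by rewrite addmC submK.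
apply: memN_msupp_eq0; apply/negP => /Ng Nb.
have tP := normal_mul_x0 P_pommaret Nb; rewrite eq_t in tP.
have [|i eq_i] := (alpha_enum t).1.
  split; first exact: tP.
  by move/mnm_lepP: le_t => /(_ ord0); rewrite mnm1E eqxx.
by have := no_i i; rewrite eq_i eqxx.
Qed.

End MarkedBasis.

Theorem theorem5p2 (K : fieldType) (n : nat)
    (J : {mpoly K[n.+1]} -> Prop) (P : seq 'X_{1..n.+1})
    (h : 'X_{1..n.+1} -> {mpoly K[n.+1]}) (I : {mpoly K[n.+1]} -> Prop)
    (r : nat) (alpha : 'I_r -> 'X_{1..n.+1}) (A : 'I_n.+1 -> 'M[K]_r)
    (J_quasi_stable : quasi_stable J)
    (P_pommaret : pommaret_basis J P)
    (h_basis : marked_basis J P h)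
    (I_artinian : artinian I)
    (I_homogeneous : homogeneous_ideal I)
    (I_generated : forall f, I f <-> marked_ideal P h f)
    (alpha_inj : injective alpha)
    (alpha_enum : forall m,
       (m \in P /\ (0 < m ord0)%N) <-> exists i : 'I_r, alpha i = m)
    (A_matrices : forall k : 'I_n.+1, k != ord0 ->
       is_rep_matrix J P h alpha k (A k)) :
  direct_sum (colon I (@irrelevant_ideal K n.+1)) I
    (kspan (fun f : {mpoly K[n.+1]} => exists c : 'cV[K]_r,
       [/\ f = \sum_(i < r) c i 0 *: div_x0 (x0_part (h (alpha i))),
           \sum_(i < r) c i 0 *: x0_free_part (h (alpha i)) = 0 &
           forall k : 'I_n.+1, k != ord0 -> A k *m c = 0])).
Proof.
have I_ideal : is_ideal I by case: I_homogeneous.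
have [I0 ID IM] := I_ideal.
set S := fun f => exists c : 'cV[K]_r, _.
have S_quot f : S f <-> exists c : 'cV[K]_r,
    'X_ord0 * f = \sum_(i < r) c i 0 *: h (alpha i) /\
    forall k, k != ord0 -> A k *m c = 0.
  split=> [[c [eq_f free0 Ac]]|[c [/x0_quotientP[eq_f free0] Ac]]];
    exists c => //.
  by split=> //; apply/x0_quotientP.
have S_normal f : S f -> normal_supp J f.
  by case/S_quot => c [eq_f _]; exact: (x0_quotient_normal P_pommaret h_basis
    alpha_enum eq_f).
have A_mul (c : 'cV[K]_r) f k : k != ord0 ->
    'X_ord0 * f = \sum_(i < r) c i 0 *: h (alpha i) ->
    exists2 v, I v &
      'X_ord0 * ('X_k * f - v) = \sum_(i < r) (A k *m c) i 0 *: h (alpha i).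
  move=> k0; exact: (rep_matrix_mul P_pommaret h_basis I_homogeneous
                       I_generated alpha_inj alpha_enum (A_matrices k k0)).
have S_mulX f k : S f -> I ('X_k * f).
  case/S_quot => c [eq_f Ac]; case: (eqVneq k ord0) => [->|k0].
    rewrite eq_f; apply: ideal_sum => // i _; apply: idealZ => //.
    by apply: (marked_mem I_generated);
      case: ((alpha_enum (alpha i)).2 (ex_intro _ i erefl)).
  have [v Iv eq_v] := A_mul c f k k0 eq_f.
  (* As A_k c = 0, the relation [eq_v] has zero right-hand side, so x_k f equals v, an element of
     [I]. *)
  suff /subr0_eq-> : 'X_k * f - v = 0 by [].
  apply: (@mulX_inj _ _ ord0); rewrite /= eq_v mulr0 big1 // => i _.
  by rewrite Ac // mxE scale0r.
split=> [f|f If].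
  rewrite colon_irrelevantP //; split=> [If|[g1 [g2 [I1 S2 ->]]] k].
    have [g Ng Ifg] := marked_decomposition h_basis I_homogeneous I_generated f.
    have Ig k : I ('X_k * g).
      rewrite -[g](subKr f) mulrBr; apply: idealB => //; exact: IM.
    exists (f - g), g; split; rewrite ?subrK //.
    exists [:: (1, g)]; split; last by rewrite big_seq1 scale1r.
    move=> u; rewrite inE => /eqP -> /=; apply/S_quot.
    have [c eq_g] := normal_x0_comb P_pommaret h_basis I_homogeneous
                       I_generated alpha_inj alpha_enum Ng (Ig ord0).
    exists c; split=> // k k0.
    have [v Iv eq_v] := A_mul c g k k0 eq_g.
    (* Both x_k g and v lie in [I], while [eq_v] makes their difference normal. *)
    have eq0 : 'X_k * g - v = 0.
      apply: (normal_ideal_eq0 h_basis I_homogeneous I_generated) => //;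
        first exact: idealB.
      exact: (x0_quotient_normal P_pommaret h_basis alpha_enum eq_v).
    apply/matrixP => i j; rewrite (ord1 j) [RHS]mxE.
    (* An entry of A_k c is the coefficient at its head of the combination in [eq_v], which is now
       zero. *)
    rewrite -(mcoeff_comb_head P_pommaret h_basis alpha_inj alpha_enum
                (fun i => (A k *m c) i 0)).
    by rewrite -eq_v eq0 mulr0 mcoeff0.
  rewrite mulrDr; apply: (ID); first exact: IM.
  apply: (@kspan_ind _ _ S (fun g => I ('X_k * g)) _ _ _ g2 S2) => [|a f1 f2
    If1 If2|f1 /S_mulX //].
    by rewrite mulr0.
  by rewrite mulrDr -scalerAr; apply: ID => //; apply: idealZ.
move=> Sf; apply: (normal_ideal_eq0 h_basis I_homogeneous I_generated) => //.
apply: (@kspan_ind _ _ S (normal_supp J) _ _ S_normal f Sf) => [t|a f1 f2];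
  first by rewrite msupp0.
exact: normal_supp_lin.
Qed.
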